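(* Let $t$ be a positive integer. The uniform theta graph $\Theta(t,2)$ is determined by its normalized Laplacian spectrum; that is, every graph $H$ without isolated vertices satisfying $\operatorname{Spec}(\mathcal{L}(H)) = \operatorname{Spec}(\mathcal{L}(\Theta(t,2)))$ is isomorphic to $\Theta(t,2)$.
   Context: Graphs are simple and finite. For a graph $G$ without isolated vertices, with adjacency matrix $A$ and diagonal degree matrix $D$, the normalized Laplacian matrix is $\mathcal{L}(G)=I-D^{-1/2}AD^{-1/2}$. $\operatorname{Spec}(M)$ denotes the multiset of eigenvalues of $M$ counted with algebraic multiplicity. The uniform theta graph $\Theta(t,2)$ is obtained from $t$ pairwise vertex-disjoint path graphs on $2$ vertices by adding two new vertices and, for each path, joining one endpoint to the first new vertex and the other endpoint to the second new vertex. *)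

(* Defs.v *)
From HB Require Import structures.
From mathcomp Require Import all_boot all_order all_algebra.
From mathcomp Require Import finmap multiset.

Set Implicit Arguments.
Unset Strict Implicit.
Unset Printing Implicit Defensive.

Import Order.TTheory GRing.Theory Num.Theory.
Local Open Scope ring_scope.

Record graph := Graph {
  vertex :> finType;
  adj : rel vertex;
  adj_sym : symmetric adj;
  adj_irrefl : irreflexive adj
}.

Definition degree (G : graph) (x : G) : nat := #|[set y | adj x y]|.

Definition no_isolated_vertices (G : graph) : Prop :=
  forall x : G, exists y : G, adj x y.

Definition isomorphic (G H : graph) : Prop :=
  exists2 f : G -> H, bijective f & forall x y, adj (f x) (f y) = adj x y.

(* Rows and columns of the matrices of G are indexed by 'I_#|G|, identified
   with the vertices of G by enum_val.  The field C is an algebraically closed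
   field with conjugation, such as algC or R[i] for a real closed field R. *)
Definition adjacency_mx (C : numClosedFieldType) (G : graph) : 'M[C]_#|G| :=
  \matrix_(i, j) (adj (enum_val i) (enum_val j))%:R.

(* The matrix D^{-1/2}.  Its diagonal entry at an isolated vertex is 0, since
   0^-1 = 0. *)
Definition degree_invsqrt_mx (C : numClosedFieldType) (G : graph) :
    'M[C]_#|G| :=
  diag_mx (\row_i (sqrtC (degree (enum_val i))%:R)^-1).

Definition normalized_laplacian (C : numClosedFieldType) (G : graph) :
    'M[C]_#|G| :=
  1%:M - degree_invsqrt_mx C G *m adjacency_mx C G *m degree_invsqrt_mx C G.

(* closed_field_poly_normal p is a sequence r with a proof that
   p = lead_coef p *: \prod_(z <- r) ('X - z%:P). *)
Definition Spec (C : closedFieldType) (n : nat) (M : 'M[C]_n) : {mset C}%mset :=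
  seq_mset (sval (closed_field_poly_normal (char_poly M))).

Lemma Spec_mup (C : closedFieldType) (n : nat) (M : 'M[C]_n) (x : C) :
  Spec M x = mup x (char_poly M).
Proof.
rewrite /Spec; case: closed_field_poly_normal => r /=.
rewrite (monicP (char_poly_monic M)) scale1r => ->.
by rewrite mset_seqE mu_prod_XsubC.
Qed.

(* inl false and inl true are the two new vertices; inr (i, false) and
   inr (i, true) are the vertices of the i-th path, joined respectively to
   inl false and inl true. *)
Definition theta2_adj (t : nat) : rel (bool + ('I_t * bool))%type :=
  fun u v => match u, v with
  | inl _, inl _ => false
  | inl a, inr (_, b) => a == b
  | inr (_, b), inl a => a == b
  | inr (i, b), inr (j, c) => (i == j) && (b != c)
  end.

Lemma theta2_adj_sym (t : nat) : symmetric (@theta2_adj t).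
Proof.
by move=> [a|[i b]] [c|[j d]] //=; rewrite eq_sym [d == b]eq_sym.
Qed.

Lemma theta2_adj_irrefl (t : nat) : irreflexive (@theta2_adj t).
Proof. by move=> [a|[i b]] //=; rewrite !eqxx. Qed.

Definition theta2 (t : nat) : graph :=
  Graph (@theta2_adj_sym t) (@theta2_adj_irrefl t).

(* Main.v *)
(* Let N = 1 - L be the normalized adjacency matrix.  For Theta(t,2) every
   eigenvalue of N is 1, -1, 1/2 or -1/2, -1 does occur, and tr(4N^2 - 1) = 6.
   For a cospectral graph H this forces 4N^2 - 1 to be 3 times the sum of the
   orthogonal projections onto two eigenvectors: D^{1/2} 1, for the eigenvalue
   1, and D^{1/2} g, for the eigenvalue -1.  Hence g changes sign along every
   edge and g^2 is constant, so that H is bipartite, and comparing entries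
   gives, for x, x' on the same side and with m the number of edges,
     sum_{y ~ x, x'} 1/d_y = [x = x'] d_x/4 + 3 d_x d_x'/(4m).
   Both sides have n = t + 1 vertices.  A vertex of degree 1 forces n = 2 and
   m = 3.  If the least degree is 2, the two neighbours of a vertex of degree 2
   have degrees d1, d2 with d1 + d2 = n + 1 and 1/d1 + 1/d2 = 1/2 + 3/m; either
   one of these is 2, which gives the structure of Theta(t,2), or they are 3
   and 3, 4 or 5, and all three cases are impossible.  If all degrees are at
   least 3, each side has exactly one vertex of degree 3, so 9 d_x^2 <= m for
   all x, which contradicts 4m <= 9 d_x' d_y for x of degree 3 and a common
   neighbour y of x and x'. *)
Require Import Defs.
From mathcomp Require Import all_boot all_order all_algebra.
From mathcomp Require Import finmap multiset.
From mathcomp Require Import spectral.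
From mathcomp Require Import zify ring lra.

Set Implicit Arguments.
Unset Strict Implicit.
Unset Printing Implicit Defensive.

Import Order.TTheory GRing.Theory Num.Theory.
Local Open Scope ring_scope.
Local Open Scope sesquilinear_scope.

(** * Spectra of Hermitian matrices *)

Lemma char_poly_Spec (C : closedFieldType) (n : nat) (M : 'M[C]_n) :
  char_poly M = \prod_(z <- Spec M) ('X - z%:P).
Proof.
rewrite /Spec; case: closed_field_poly_normal => r /=.
rewrite (monicP (char_poly_monic M)) scale1r => ->.
by apply: perm_big; rewrite perm_sym perm_eq_seq_mset.
Qed.

Lemma char_poly_similar (F : fieldType) n (P A : 'M[F]_n) : P \in unitmx ->
  char_poly (invmx P *m A *m P) = char_poly A.
Proof.
move=> uP; rewrite /char_poly /char_poly_mx !map_mxM /=.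
set Q := map_mx _ P; set Q' := map_mx _ (invmx P).
have QQ : Q' *m Q = 1%:M by rewrite -map_mxM mulVmx // map_mx1.
have -> : ('X%:M - Q' *m map_mx polyC A *m Q)
        = Q' *m ('X%:M - map_mx polyC A) *m Q.
  by rewrite mulmxBr mulmxBl mul_mx_scalar -scalemxAl QQ scalemx1.
rewrite !det_mulmx mulrAC -det_mulmx QQ det1 mul1r //.
Qed.

Lemma hermitian_spectrum (C : numClosedFieldType) n (A : 'M[C]_n) :
  A^t* = A -> exists P d, [/\ P \in unitmx, A = invmx P *m diag_mx d *m P
    & char_poly A = \prod_i ('X - (d 0 i)%:P)].
Proof.
move=> hA; have nA : A \is normalmx by apply/normalmxP; rewrite hA.
exists (spectralmx A), (spectral_diag A); split; first exact: spectral_unit.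
  exact/orthomx_spectralP.
rewrite {1}(orthomx_spectralP nA) char_poly_similar ?spectral_unit //.
rewrite char_poly_trig ?diag_mx_is_trig //.
by apply: eq_bigr => i _; rewrite !mxE eqxx.
Qed.

Lemma mul_sub1_similar (C : fieldType) n (P : 'M[C]_n) d : P \in unitmx ->
  let A := invmx P *m diag_mx d *m P in
  (1%:M - A) *m (1%:M - A)
    = invmx P *m diag_mx (\row_i (1 - d 0 i) ^+ 2) *m P.
Proof.
move=> uP A.
have -> : 1%:M - A = invmx P *m diag_mx (\row_i (1 - d 0 i)) *m P.
  rewrite -{1}(mulVmx uP) -{1}[invmx P]mulmx1 -mulmxBl -mulmxBr.
  congr (_ *m _ *m _); apply/matrixP => i j; rewrite !mxE.
  by case: eqP => _; rewrite /= ?mulr1n ?mulr0n ?subr0.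
rewrite -!mulmxA [P *m _]mulmxA mulmxV // mul1mx [diag_mx _ *m _]mulmxA.
rewrite mulmx_diag; congr (_ *m (_ *m _)); congr diag_mx.
by apply/rowP => i; rewrite !mxE expr2.
Qed.

(** Both traces are the sum of [(1 - z) ^+ 2] over the roots [z] of the common characteristic
    polynomial. The sizes [n] and [n'] are kept apart because the matrices of two graphs are indexed
    by different cardinals. *)
Lemma trace_sq_sub1 (C : numClosedFieldType) n n' (A : 'M[C]_n) (B : 'M[C]_n') :
  A^t* = A -> B^t* = B -> char_poly A = char_poly B ->
  \tr ((1%:M - A) *m (1%:M - A)) = \tr ((1%:M - B) *m (1%:M - B)).
Proof.
move=> /hermitian_spectrum[P [d [uP eA cA]]] /hermitian_spectrum[Q [e [uQ eB cB]]].
rewrite cA cB => ecp.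
have pe : perm_eq [seq d 0 i | i <- index_enum 'I_n]
                  [seq e 0 i | i <- index_enum 'I_n'].
  by apply: prod_XsubC_eq; rewrite !big_map.
rewrite eA eB !mul_sub1_similar // mxtrace_mulC [RHS]mxtrace_mulC.
rewrite !mulmxA !mulmxV // !mul1mx.
rewrite !mxtrace_diag.
under eq_bigr do rewrite mxE; under [RHS]eq_bigr do rewrite mxE.
rewrite -(big_map (fun i => d 0 i) predT (fun z => (1 - z) ^+ 2)).
by rewrite (perm_big _ pe) big_map.
Qed.

(** By diagonalization it suffices that [4 q^2 - 5 q + 1 = (4 q - 1) (q - 1)] vanishes at
    [q = (1 - z)^2] for every eigenvalue [z]. *)
Lemma annihilated_sub1 (C : numClosedFieldType) n (A : 'M[C]_n) :
  A^t* = A ->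
  (forall z, root (char_poly A) z -> (1 - z) ^+ 2 = 1 \/ 4 * (1 - z) ^+ 2 = 1) ->
  let Q := (1%:M - A) *m (1%:M - A) in 4 *: (Q *m Q) = 5 *: Q - 1%:M.
Proof.
move=> /hermitian_spectrum[P [d [uP eA cA]]] rA Q.
rewrite /Q eA mul_sub1_similar // -!mulmxA [P *m _]mulmxA mulmxV // mul1mx.
rewrite [diag_mx _ *m _]mulmxA mulmx_diag.
have -> : 1%:M = invmx P *m (1%:M *m P) by rewrite mul1mx mulVmx.
rewrite ![_ *: (invmx P *m _)]scalemxAr -mulmxBr ![_ *: (_ *m P)]scalemxAl -mulmxBl.
congr (_ *m (_ *m _)); apply/matrixP => i j; rewrite !mxE.
case: eqP => _; rewrite /= ?mulr1n ?mulr0n; last by ring.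
have /rA : root (char_poly A) (d 0 i).
  by rewrite cA (bigD1 i) //= rootM root_XsubC eqxx.
case=> e; first by rewrite e; ring.
by apply/eqP; rewrite -subr_eq0; apply/eqP;
   transitivity ((4 * (1 - d 0 i) ^+ 2 - 1) * ((1 - d 0 i) ^+ 2 - 1));
  [ring | rewrite e; ring].
Qed.

Lemma trace_mul_conj_eq0 (C : numClosedFieldType) n (F : 'M[C]_n) :
  \tr (F *m F^t*) = 0 -> F = 0.
Proof.
rewrite /mxtrace => h; apply/matrixP => i j; rewrite mxE.
have h' k : 0 <= (F *m F^t*) k k.
  rewrite mxE; apply: sumr_ge0 => l _; rewrite !mxE; exact: mul_conjC_ge0.
have := psumr_eq0P (fun k _ => h' k) h (i := i) isT; rewrite mxE.
have h2 l : 0 <= F i l * F^t* l i by rewrite !mxE mul_conjC_ge0.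
move=> h3; have := psumr_eq0P (fun k _ => h2 k) h3 (i := j) isT.
by rewrite !mxE => /eqP; rewrite mul_conjC_eq0 => /eqP.
Qed.

Lemma mul_conj_row_eq0 (C : numClosedFieldType) n (v : 'rV[C]_n) :
  (v *m v^t*) 0 0 = 0 -> v = 0.
Proof.
rewrite mxE => h; apply/rowP => j; rewrite mxE.
have h2 l : 0 <= v 0 l * v^t* l 0 by rewrite !mxE mul_conjC_ge0.
have := psumr_eq0P (fun k _ => h2 k) h (i := j) isT.
by rewrite !mxE => /eqP; rewrite mul_conjC_eq0 => /eqP.
Qed.

(* The difference of the two sides is a Hermitian idempotent of trace zero. *)
Lemma spectral_projections (C : numClosedFieldType) n (N : 'M[C]_n) (v w : 'rV[C]_n) :
  N^t* = N -> v *m N = v -> w *m N = - w -> v != 0 -> w != 0 ->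
  4 *: ((N *m N) *m (N *m N)) = 5 *: (N *m N) - 1%:M ->
  4 * \tr (N *m N) = n%:R + 6 ->
  4 *: (N *m N) - 1%:M =
  (3 / (v *m v^t*) 0 0) *: (v^t* *m v) + (3 / (w *m w^t*) 0 0) *: (w^t* *m w).
Proof.
move=> hN vN wN v0 w0 ann trN; set a := (v *m v^t*) 0 0; set b := (w *m w^t*) 0 0.
have a0 : a != 0 by apply: contra_neq v0 => /mul_conj_row_eq0.
have b0 : b != 0 by apply: contra_neq w0 => /mul_conj_row_eq0.
have aE : v *m v^t* = a%:M by rewrite [LHS]mx11_scalar.
have bE : w *m w^t* = b%:M by rewrite [LHS]mx11_scalar.
have Nv : N *m v^t* = v^t* by rewrite -{1}hN -map_mxM -trmx_mul vN.
have Nw : N *m w^t* = - w^t*.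
  by rewrite -{1}hN -map_mxM -trmx_mul wN linearN /= map_mxN.
(* Eigenvectors for the distinct eigenvalues 1 and -1 are orthogonal: moving [N] across the product
   changes its sign. *)
have vw : v *m w^t* = 0.
  have : v *m N *m w^t* = v *m (N *m w^t*) by rewrite mulmxA.
  rewrite vN Nw mulmxN => /eqP; rewrite -addr_eq0 -mulr2n -scaler_nat.
  by rewrite scaler_eq0 pnatr_eq0 /= => /eqP.
have wv : w *m v^t* = 0.
  have : w *m N *m v^t* = w *m (N *m v^t*) by rewrite mulmxA.
  rewrite wN Nv mulNmx => /eqP; rewrite eq_sym -addr_eq0 -mulr2n -scaler_nat.
  by rewrite scaler_eq0 pnatr_eq0 /= => /eqP.
set Q := N *m N in ann trN *.
set V := v^t* *m v; set W := w^t* *m w.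
have vQ : v *m Q = v by rewrite mulmxA !vN.
have wQ : w *m Q = w by rewrite mulmxA wN mulNmx wN opprK.
have Qv : Q *m v^t* = v^t* by rewrite -mulmxA !Nv.
have Qw : Q *m w^t* = w^t* by rewrite -mulmxA Nw mulmxN Nw opprK.
have VV : V *m V = a *: V.
  by rewrite /V mulmxA -[v^t* *m v *m _]mulmxA aE mul_mx_scalar scalemxAl.
have WW : W *m W = b *: W.
  by rewrite /W mulmxA -[w^t* *m w *m _]mulmxA bE mul_mx_scalar scalemxAl.
have VW : V *m W = 0 by rewrite /V /W mulmxA -[v^t* *m v *m _]mulmxA vw mulmx0 mul0mx.
have WV : W *m V = 0 by rewrite /V /W mulmxA -[w^t* *m w *m _]mulmxA wv mulmx0 mul0mx.
have QV : Q *m V = V by rewrite mulmxA Qv.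
have VQ : V *m Q = V by rewrite -mulmxA vQ.
have QW : Q *m W = W by rewrite mulmxA Qw.
have WQ : W *m Q = W by rewrite -mulmxA wQ.
pose S := 4 *: Q - 1%:M; pose R := (3 / a) *: V + (3 / b) *: W.
pose F := S - R.
apply/eqP; rewrite -subr_eq0 -/S -/R -/F; apply/eqP.
have conjV : V^t* = V by rewrite /V trmx_mul map_mxM /= trmxCK.
have conjW : W^t* = W by rewrite /W trmx_mul map_mxM /= trmxCK.
have conjQ : Q^t* = Q by rewrite /Q trmx_mul map_mxM /= hN.
(* [S / 3] and [R / 3] are projections, and the image of [R] lies in that of [S] because
   [S R = R S = 3 R]. Hence [F / 3] is a projection too. *)
have SS : S *m S = 3 *: S.
  rewrite /S mulmxBl mulmxBr !mulmx1 mul1mx -scalemxAl -scalemxAr scalerA.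
  rewrite -scalerA ann.
  apply/matrixP => i j; rewrite !mxE; ring.
have QR : Q *m R = R by rewrite mulmxDr -!scalemxAr QV QW.
have RQ : R *m Q = R by rewrite mulmxDl -!scalemxAl VQ WQ.
have SR : S *m R = 3 *: R.
  rewrite mulmxBl mul1mx -scalemxAl QR.
  by apply/matrixP => i j; rewrite !mxE; ring.
have RS : R *m S = 3 *: R.
  rewrite mulmxBr mulmx1 -scalemxAr RQ.
  by apply/matrixP => i j; rewrite !mxE; ring.
have RR : R *m R = 3 *: R.
  rewrite {1}/R mulmxDl -!scalemxAl /R !mulmxDr -!scalemxAr VV WW VW WV.
  rewrite !scaler0 addr0 add0r !scalerA -!mulrA !mulVf // !mulr1 scalerDr !scalerA.
  by rewrite -![_^-1 * 3]mulrC.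
have FF : F *m F = 3 *: F.
  rewrite /F; move: SS SR RS RR; move: S R {F QR RQ} => S R SS SR RS RR.
  by rewrite mulmxBl !mulmxBr SS SR RS RR subrr subr0 scalerBr.
have conjZ c (M : 'M[C]_n) : c^* = c -> M^t* = M -> (c *: M)^t* = c *: M.
  by move=> ec eM; rewrite linearZ /= map_mxZ /= ec eM.
have conjB (M M' : 'M[C]_n) : M^t* = M -> M'^t* = M' -> (M - M')^t* = M - M'.
  by move=> eM eM'; rewrite linearB /= map_mxB eM eM'.
have conjD (M M' : 'M[C]_n) : M^t* = M -> M'^t* = M' -> (M + M')^t* = M + M'.
  by move=> eM eM'; rewrite linearD /= map_mxD eM eM'.
have conj_norm (u : 'rV[C]_n) : ((u *m u^t*) 0 0)^* = (u *m u^t*) 0 0.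
  rewrite mxE rmorph_sum; apply: eq_bigr => i _.
  by rewrite !mxE rmorphM /= conjCK mulrC.
have conjF : F^t* = F.
  apply: (conjB); [apply: (conjB) | apply: (conjD)].
  - by apply: (conjZ); rewrite ?conjC_nat.
  - by rewrite trmx1 map_mx1.
  - by apply: (conjZ); rewrite // rmorphM fmorphV /= conj_norm conjC_nat.
  - by apply: (conjZ); rewrite // rmorphM fmorphV /= conj_norm conjC_nat.
apply: trace_mul_conj_eq0; rewrite conjF FF.
have trV : \tr V = a by rewrite /V mxtrace_mulC aE mxtrace_scalar.
have trW : \tr W = b by rewrite /W mxtrace_mulC bE mxtrace_scalar.
(* [S] has trace [(n + 6) - n] and [R] has trace [3 + 3], so [F] has trace 0. *)
rewrite mxtraceZ /F /S /R !(linearB, linearD) /= !mxtraceZ trV trW mxtrace1 trN.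
rewrite !divfK //; ring.
Qed.

(** * Bipartite graphs with a prescribed Gram matrix *)

(** These are the entries of [A D^-1 A], that is, those of [N^2] without the factors [1 / sqrt d_x]
    and [1 / sqrt d_x']. *)
Definition codegree (R : fieldType) (G : graph) (x x' : G) : R :=
  \sum_(y | adj x y && adj x' y) (degree y)%:R^-1.

Lemma degree2_neighbourhood (G : graph) (x y : G) : degree x = 2%N -> adj x y ->
  exists2 y', y != y' & [set z | adj x z] = [set y; y'].
Proof.
move=> dx xy; have : #|[set z | adj x z] :\ y| == 1%N.
  by have := cardsD1 y [set z | adj x z]; rewrite inE xy -/(degree x) dx; lia.
case/cards1P => y' Ny'; exists y'.
  by have /setP/(_ y') := Ny'; rewrite !inE eqxx eq_sym => /andP[].
by rewrite -Ny' setD1K ?inE.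
Qed.

Section Gram.

Variables (G : graph) (c : G -> bool) (n m : nat).
Hypothesis noiso : no_isolated_vertices G.
Hypothesis c_adj : forall x y : G, adj x y -> c y = ~~ c x.
Hypothesis card_side : forall b, #|[set x | c x == b]| = n.
Hypothesis sum_side : forall b, (\sum_(x | c x == b) degree x)%N = m.
Hypothesis n_gt1 : (1 < n)%N.
Hypothesis gram : forall x x', c x = c x' ->
  4 * m%:R * codegree rat x x' =
  (x == x')%:R * m%:R * (degree x)%:R + 3 * (degree x)%:R * (degree x')%:R.

Local Notation d x := ((degree x)%:R : rat).
Local Notation M := (m%:R : rat).

Lemma degree_gt0 (x : G) : (0 < degree x)%N.
Proof. by have [y xy] := noiso x; apply/card_gt0P; exists y; rewrite inE. Qed.

Lemma c_adj2 (x y z : G) : adj x y -> adj x z -> c y = c z.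
Proof. by move=> /c_adj-> /c_adj->. Qed.

Lemma degree_le_side (x : G) : (degree x <= n)%N.
Proof.
rewrite -(card_side (~~ c x)); apply/subset_leq_card/subsetP => y.
by rewrite !inE => /c_adj ->.
Qed.

Lemma sum_side_split (x : G) :
  m = (degree x + \sum_(y | (c y == c x) && (y != x)) degree y)%N.
Proof. by rewrite -(sum_side (c x)) (bigD1 x). Qed.

Lemma card_side_split (x : G) :
  (\sum_(y | (c y == c x) && (y != x)) 1 = n.-1)%N.
Proof.
rewrite -(card_side (c x)) -sum1_card [in RHS](bigD1 x) ?inE //=.
by apply: eq_bigl => y; rewrite inE.
Qed.

Lemma exists_other (x : G) : exists2 y, c y = c x & y != x.
Proof.
have : (0 < \sum_(y | (c y == c x) && (y != x)) 1)%N.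
  by rewrite card_side_split; lia.
rewrite sum1_card => /card_gt0P[y /andP[/eqP cy yx]].
by exists y.
Qed.

Lemma sum_side_gt0 : (0 < m)%N.
Proof.
case: (pickP (mem [set x | c x == true])) => [x _|h].
  by rewrite (sum_side_split x) addn_gt0 degree_gt0.
by have := n_gt1; rewrite -(card_side true) (eq_card0 h).
Qed.

(** The right-hand side of [gram] is positive, so the sum defining the codegree cannot be empty. *)
Lemma common_neighbour (x x' : G) : c x = c x' -> exists2 y, adj x y & adj x' y.
Proof.
move=> /gram; case: (pickP [pred y | adj x y && adj x' y]) => [y /andP[] | h].
  by exists y.
rewrite /codegree big_pred0 // mulr0 => /esym/eqP.
rewrite paddr_eq0 ?mulr_ge0 //; case/andP => _.
by rewrite !mulf_eq0 !pnatr_eq0 !eqn0Ngt !degree_gt0.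
Qed.

Lemma inv_degree_ge0 (x : G) : 0 <= (d x)^-1.
Proof. by rewrite invr_ge0. Qed.

Lemma codegree_ge (x x' y : G) : adj x y -> adj x' y ->
  (d y)^-1 <= codegree rat x x'.
Proof.
move=> xy x'y; rewrite /codegree (bigD1 y) /= ?xy //.
by rewrite lerDl sumr_ge0 // => z _; exact: inv_degree_ge0.
Qed.

Lemma codegree_diag (R : fieldType) (x : G) :
  codegree R x x = \sum_(y in [set y | adj x y]) (degree y)%:R^-1.
Proof. by apply: eq_bigl => y; rewrite inE andbb. Qed.

Lemma inv_degree_le k (y : G) : (0 < k)%N -> (k <= degree y)%N ->
  (d y)^-1 <= k%:R^-1.
Proof. by move=> k0 ky; rewrite lef_pV2 ?posrE ?ltr0n ?ler_nat ?degree_gt0. Qed.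

Lemma codegree_diag_le k (x : G) : (0 < k)%N ->
  (forall y, adj x y -> (k <= degree y)%N) -> k%:R * codegree rat x x <= d x.
Proof.
move=> k0 ky; rewrite codegree_diag mulr_sumr -[degree x]sum1_card natr_sum.
apply: ler_sum => y; rewrite inE => /ky kd.
by rewrite -ler_pdivlMl ?ltr0n // mulr1 inv_degree_le.
Qed.

Lemma gram_diag (x : G) : 4 * M * codegree rat x x = M * d x + 3 * d x * d x.
Proof. by rewrite gram // eqxx mul1r. Qed.

Lemma gram_neq (x x' : G) : c x = c x' -> x != x' ->
  4 * M * codegree rat x x' = 3 * d x * d x'.
Proof. by move=> cx /negPf xx'; rewrite gram // xx' !mul0r add0r. Qed.

Lemma M_gt0 : 0 < M. Proof. by rewrite ltr0n sum_side_gt0. Qed.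
Lemma d_gt0 (x : G) : 0 < d x. Proof. by rewrite ltr0n degree_gt0. Qed.

(* For k >= 4 the right-hand side is 0, hence no such x exists. *)
Lemma degree_bound k (x : G) : (0 < k)%N ->
  (forall y, adj x y -> (k <= degree y)%N) ->
  (3 * k * degree x <= (4 - k) * m)%N.
Proof.
move=> k0 /(codegree_diag_le k0) h.
have k4 : (k < 4)%N.
  rewrite ltnNge -(ler_nat rat); apply/negP => k4.
  have := gram_diag x; have := M_gt0; have := d_gt0 x.
  have : 4 * codegree rat x x <= d x.
    apply: le_trans h; apply: ler_wpM2r => //.
    by apply: sumr_ge0 => y _; exact: inv_degree_ge0.
  nra.
have h2 : 3 * k%:R * d x <= (4 - k%:R) * M.
  have := gram_diag x; have := M_gt0; have := d_gt0 x => dx M0 e.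
  (* By [gram_diag], the claim multiplied by [d x] is the inequality [k * codegree rat x x <= d x]
     scaled by [4 * M]. *)
  have e2 : d x * (3 * k%:R * d x - (4 - k%:R) * M)
     = 4 * M * (k%:R * codegree rat x x - d x).
    transitivity (k%:R * (M * d x + 3 * d x * d x) - 4 * M * d x); first ring.
    by rewrite -e; ring.
  rewrite -subr_le0 -(pmulr_rle0 _ dx) e2.
  by rewrite pmulr_rle0 ?subr_le0 ?mulr_gt0.
by rewrite -(ler_nat rat) !natrM natrB // ltnW.
Qed.

(** Two degrees are kept exact; each of the other [n - 2] vertices of the side has degree between
    [k] and [n]. *)
Lemma side_bounds k (x z : G) : (forall w : G, (k <= degree w)%N) ->
  c z = c x -> z != x ->
  (degree x + degree z + (n - 2) * k <= m <= degree x + degree z + (n - 2) * n)%N.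
Proof.
move=> hk cz zx; rewrite (sum_side_split x) (bigD1 z) /= ?cz ?eqxx //.
have card_rest : (\sum_(y | (c y == c x) && (y != x) && (y != z)) 1 = n - 2)%N.
  by have := card_side_split x; rewrite (bigD1 z) /= ?cz ?eqxx //; lia.
rewrite addnA !leq_add2l -card_rest !big_distrl /= !mul1n.
by rewrite !leq_sum // => y _; exact: degree_le_side.
Qed.

(** [x0] and [y0] are the hubs of Theta(n - 1, 2), which lie on opposite sides. With the bipartition
    into sides of size [n], these conditions determine the graph: see [theta_shape_isomorphic]. *)
Definition theta_shape := exists x0 y0 : G,
  [/\ c y0 = ~~ c x0, ~~ adj x0 y0, degree x0 = n.-1, degree y0 = n.-1
    & forall z, z != x0 -> z != y0 -> degree z = 2%N].

(** Every vertex on the side of the leaf [x] shares a neighbour with [x], which can only be [y]; so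
    [y] has degree [n], and [gram] at [x] reads [4 m = n (m + 3)]. The outcome is the path on 4
    vertices, with its two leaves as hubs. *)
Lemma leaf_shape (x : G) : degree x = 1%N -> theta_shape.
Proof.
move=> dx; have /cards1P[y Nx] : #|[set y | adj x y]| == 1%N by rewrite -dx.
have xyE z : adj x z = (z == y) by have /setP/(_ z) := Nx; rewrite !inE.
have cy : c y = ~~ c x by rewrite (@c_adj x) // xyE.
have dy : degree y = n.
  rewrite -(card_side (c x)); apply: eq_card => x'; rewrite !inE.
  apply/idP/eqP => [/c_adj -> | /common_neighbour[z]]; first by rewrite cy negbK.
  by rewrite adj_sym [adj x z]xyE => zx' /eqP <-.
have cg : codegree rat x x = n%:R^-1.
  by rewrite codegree_diag Nx big_set1 dy.
have n0 : 0 < n%:R :> rat by rewrite ltr0n; lia.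
have e : (4 * m = n * (m + 3))%N.
  apply/eqP; rewrite -(eqr_nat rat) !natrM natrD.
  have := gram_diag x; rewrite cg dx => e.
  rewrite -[4 * M](mulfVK (lt0r_neq0 n0)) e; apply/eqP; ring.
have bnd z : c z = c x -> z != x ->
    (1 + degree z + (n - 2) <= m <= 1 + degree z + (n - 2) * n)%N.
  by move=> cz zx; have := side_bounds degree_gt0 cz zx; rewrite dx muln1.
have [z cz zx] := exists_other x; have := bnd z cz zx; have := degree_le_side z.
move=> dz bz.
(* The equation excludes [n >= 4]; for [n = 3] it gives [m = 9], above the bound [1 + 3 + 3]. *)
have n2 : n = 2%N.
  have n4 : (n < 4)%N by nia.
  case: (n =P 3%N) => [n3|]; last by lia.
  by rewrite n3 in e dz bz; lia.
have m3 : m = 3%N by rewrite n2 in e; lia.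
have [y0 cy0 y0y] := exists_other y.
have bnd2 u v : c u = c v -> u != v -> (degree u + degree v = 3)%N.
  move=> cu uv; have := side_bounds degree_gt0 cu uv.
  by rewrite n2 m3 subnn !mul0n !addn0 -eqn_leq addnC => /eqP.
have dy0 : degree y0 = 1%N by have := bnd2 _ _ cy0 y0y; rewrite dy n2 addn2 => -[].
exists x, y0; rewrite cy0 cy xyE n2 dx dy0; split=> // w wx wy0.
have [cw|cw] := eqVneq (c w) (c x).
  by have := bnd2 _ _ cw wx; rewrite dx addn1 => -[].
have cw' : c w = c y0 by rewrite cy0 cy; case: (c w) (c x) cw => [] [].
by have := bnd2 _ _ cw' wy0; rewrite dy0 addn1 => -[].
Qed.

Lemma degree_sum_side (x y : G) : adj x y ->
  degree y = (\sum_(z | c z == c x) adj z y)%N.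
Proof.
move=> /c_adj cy; rewrite -[degree y]sum1_card big_mkcond [RHS]big_mkcond /=.
apply: eq_bigr => z _; rewrite inE adj_sym; case: ifP => [/c_adj|]; last by case: ifP.
by rewrite cy; case: (c z) (c x) => [] [].
Qed.

(** * The neighbourhood of a vertex of degree 2 *)

Section Degree2.

Hypothesis degree_ge2 : forall x : G, (2 <= degree x)%N.
Variables (x y1 y2 : G).
Hypothesis y12 : y1 != y2.
Hypothesis Nx : [set y | adj x y] = [set y1; y2].

Let dx : degree x = 2%N. Proof. by rewrite /degree Nx cards2 y12. Qed.
Let adjx y : adj x y = (y == y1) || (y == y2).
Proof. by have /setP/(_ y) := Nx; rewrite !inE. Qed.
Let xy1 : adj x y1. Proof. by rewrite adjx eqxx. Qed.
Let xy2 : adj x y2. Proof. by rewrite adjx eqxx orbT. Qed.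

Let codegree_x (x' : G) : codegree rat x x' =
  (adj x' y1)%:R * (d y1)^-1 + (adj x' y2)%:R * (d y2)^-1.
Proof.
rewrite /codegree big_mkcondr /=.
rewrite (eq_bigl (mem [set y1; y2])) => [|y]; last by rewrite adjx !inE.
rewrite big_setU1 ?inE //= big_set1.
by do 2!case: ifP => _; rewrite ?mul1r ?mul0r.
Qed.

(** This is [1/d1 + 1/d2 = 1/2 + 3/m], the diagonal Gram identity at [x], cleared of
    denominators. *)
Lemma degree2_neighbours :
  (2 * m * (degree y1 + degree y2) = degree y1 * degree y2 * (m + 6))%N.
Proof.
have := gram_diag x; rewrite codegree_x xy1 xy2 dx !mul1r => e.
apply/eqP; rewrite -(eqr_nat rat) !(natrM, natrD); apply/eqP.
have d1 := lt0r_neq0 (d_gt0 y1); have d2 := lt0r_neq0 (d_gt0 y2).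
transitivity (d y1 * d y2 * (4 * M * ((d y1)^-1 + (d y2)^-1)) / 2).
  by field; rewrite d1 d2.
by rewrite e; field.
Qed.

Lemma degree2_codegree (x' : G) : c x' = c x -> x' != x ->
  2 * M * ((adj x' y1)%:R * (d y1)^-1 + (adj x' y2)%:R * (d y2)^-1) = 3 * d x'.
Proof.
move=> cx; rewrite eq_sym => /(gram_neq (esym cx)); rewrite codegree_x dx => e.
apply: (@mulfI _ 2) => //; rewrite !mulrA -natrM e; ring.
Qed.

(** If [x'] were adjacent to both [y1] and [y2], comparing [gram] at [(x, x')] and [(x, x)] would
    give [3 d_x' = m + 6], against [3 d_x' <= m]. If it were adjacent to neither, [3 d_x'] would be
    0. *)
Lemma degree2_other (x' : G) : c x' = c x -> x' != x ->
  adj x' y2 = ~~ adj x' y1.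
Proof.
move=> cx xx; have e := degree2_codegree cx xx.
have : (3 * degree x' <= m)%N.
  by have := degree_bound (x := x') (k := 2) isT (fun y _ => degree_ge2 y); lia.
have := M_gt0; have d0 := d_gt0 x'; rewrite -(ler_nat rat) natrM => M0 hb.
have := gram_diag x; rewrite codegree_x xy1 xy2 dx !mul1r => e2.
case: (adj x' y1) e => /=; case: (adj x' y2) => //= e.
  by rewrite !mul1r in e; lra.
by rewrite !mul0r addr0 mulr0 in e; lra.
Qed.

(** Counting the edges at [y1] and [y2] from the side of [x]: [x] contributes 2 and each of the
    [n - 1] other vertices exactly 1. *)
Lemma degree2_count : (degree y1 + degree y2 = n.+1)%N.
Proof.
rewrite (degree_sum_side xy1) (degree_sum_side xy2) -big_split /=.
rewrite (bigD1 x) //= xy1 xy2.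
rewrite (eq_bigr (fun _ => 1%N)) ?card_side_split; first by lia.
by move=> x' /andP[/eqP cx xx]; rewrite (degree2_other cx xx); case: adj.
Qed.

(** As [x'] sees only one of [y1] and [y2], its codegree with [x] is the single term [1 / d_y]. *)
Lemma degree2_degree (x' y : G) : c x' = c x -> x' != x ->
  adj x y -> adj x' y -> (3 * degree x' * degree y = 2 * m)%N.
Proof.
move=> cx xx xy x'y; have e := degree2_codegree cx xx.
have o := degree2_other cx xx.
apply/eqP; rewrite -(eqr_nat rat) !natrM -e; apply/eqP.
move: xy; rewrite adjx => /orP[]/eqP yE; move: o x'y; rewrite yE => o x'y.
  rewrite o x'y /= mul1r mul0r addr0 mulfVK ?lt0r_neq0 ?d_gt0 //.
have {}o : adj x' y1 = false by move: o; rewrite x'y; case: adj.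
by rewrite o x'y /= mul1r mul0r add0r mulfVK ?lt0r_neq0 ?d_gt0.
Qed.

End Degree2.

Lemma exists_other_neighbour (x y : G) : (1 < degree y)%N -> adj x y ->
  exists x', [/\ adj x' y, c x' = c x & x' != x].
Proof.
move=> dy xy; have : (0 < #|[set z | adj y z] :\ x|)%N.
  by have := cardsD1 x [set z | adj y z]; rewrite inE adj_sym xy -/(degree y); lia.
case/card_gt0P=> x'; rewrite !inE => /andP[x'x yx']; exists x'.
by rewrite adj_sym yx' x'x (c_adj yx') (c_adj xy) negbK.
Qed.

(** * Graphs of least degree 2 *)

Section MinDegree2.

Hypothesis degree_ge2 : forall x : G, (2 <= degree x)%N.

(** The edge [x y1] is the middle of a path [y2, x, y1, x0] whose ends are the hubs. The relations
    at [x] give [degree y2 = n - 1] and [m = 3 (n - 1)]. Any other vertex on the side of [x] misses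
    [y1], hence meets [y2], and then [degree2_degree] forces degree 2. The other side follows by
    exchanging the roles of [x] and [y1]. *)
Lemma adjacent_degree2_shape (x y1 : G) :
  degree x = 2%N -> adj x y1 -> degree y1 = 2%N -> theta_shape.
Proof.
move=> dx xy1 dy1; have [y2 y12 Nx] := degree2_neighbourhood dx xy1.
have xy2 : adj x y2 by have /setP/(_ y2) := Nx; rewrite !inE eqxx orbT.
have [x0 xx0 Ny1] : exists2 x0, x != x0 & [set z | adj y1 z] = [set x; x0].
  by apply: degree2_neighbourhood => //; rewrite adj_sym.
have y1x0 : adj y1 x0 by have /setP/(_ x0) := Ny1; rewrite !inE eqxx orbT.
have cx0 : c x0 = c x by apply: c_adj2 y1x0 _; rewrite adj_sym.
have n2 := degree2_count degree_ge2 y12 Nx.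
have m3 : m = (3 * n.-1)%N.
  by have := degree2_neighbours y12 Nx; rewrite dy1; nia.
have x0x : x0 != x by rewrite eq_sym.
have x0y1 : adj x0 y1 by rewrite adj_sym.
have dx0 : degree x0 = n.-1.
  by have := degree2_degree degree_ge2 y12 Nx cx0 x0x xy1 x0y1; rewrite dy1; lia.
have dy2 : degree y2 = n.-1 by rewrite -[n]/(n.+1.-1) -n2 dy1.
have n20 : (0 < n.-1)%N by rewrite -ltnS prednK // ltnW.
have cancel3 k : (3 * k * n.-1 = 2 * (3 * n.-1))%N -> k = 2%N.
  by rewrite mulnAC [in RHS]mulnC => /eqP; rewrite eqn_pmul2l ?muln_gt0 // => /eqP.
exists x0, y2; split=> //; first by rewrite (c_adj xy2) cx0.
  by rewrite (degree2_other degree_ge2 y12 Nx) // x0y1.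
move=> z zx0 zy2; have [cz|cz] := eqVneq (c z) (c x).
  have [-> //|zx] := eqVneq z x.
  have zy1 : adj z y1 = false.
    have /setP/(_ z) := Ny1; rewrite !inE adj_sym => ->.
    by rewrite (negPf zx) (negPf zx0).
  have zy : adj z y2 by rewrite (degree2_other degree_ge2 y12 Nx) // zy1.
  have := degree2_degree degree_ge2 y12 Nx cz zx xy2 zy.
  by rewrite m3 dy2; exact: cancel3.
have czy1 : c z = c y1.
  by rewrite (c_adj xy1); case: (c z) (c x) cz => [] [].
have [-> //|zy1] := eqVneq z y1.
have zx : adj z x = false.
  have /setP/(_ z) := Nx; rewrite !inE adj_sym => ->.
  by rewrite (negPf zy1) (negPf zy2).
have zx0' : adj z x0 by rewrite (degree2_other degree_ge2 xx0 Ny1) // zx.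
have := degree2_degree degree_ge2 xx0 Ny1 czy1 zy1 y1x0 zx0'.
by rewrite m3 dx0; exact: cancel3.
Qed.

Lemma no_degree3_neighbour (x y1 y2 : G) : y1 != y2 ->
  [set y | adj x y] = [set y1; y2] -> (3 <= degree y1)%N ->
  (degree y1 <= degree y2)%N -> False.
Proof.
move=> y12 Nx dy1 dy12.
have m0 := sum_side_gt0.
have n2 := degree2_count degree_ge2 y12 Nx.
have e := degree2_neighbours y12 Nx.
(* If both degrees are at least 4, then [1/d1 + 1/d2 <= 1/2], which is less than [1/2 + 3/m]. *)
have dy1E : degree y1 = 3%N.
  apply/eqP; rewrite eqn_leq dy1 andbT leqNgt; apply/negP => d4.
  have : (2 * (degree y1 + degree y2) <= degree y1 * degree y2)%N by nia.
  nia.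
(* With [d = degree y2], these relations now amount to [m (6 - d) = 18 d] and [n = d + 2]. *)
rewrite dy1E in e n2.
have xy1 : adj x y1 by have /setP/(_ y1) := Nx; rewrite !inE eqxx.
have [x' [x'y1 cx' x'x]] : exists x', [/\ adj x' y1, c x' = c x & x' != x].
  by apply: exists_other_neighbour xy1; rewrite dy1E.
have := degree2_degree degree_ge2 y12 Nx cx' x'x xy1 x'y1; rewrite dy1E => dx'.
have lex' := degree_le_side x'.
have d6 : (degree y2 < 6)%N by nia.
have [d3|[d4|d5]] : degree y2 = 3%N \/ degree y2 = 4%N \/ degree y2 = 5%N by lia.
- have m18 : m = 18%N by rewrite d3 in e; lia.
  have dx4 : degree x' = 4%N by lia.
  (* If all neighbours of [x'] had degree at least 3, [degree_bound] with [k = 3] would give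
     [36 <= 18]. *)
  have [y x'y dy] : exists2 y, adj x' y & degree y = 2%N.
    have [y /andP[x'y /eqP dy]|h] := pickP [pred y | adj x' y & degree y == 2%N].
      by exists y.
    have : (3 * 3 * degree x' <= (4 - 3) * m)%N.
      apply: degree_bound => // y x'y; rewrite ltn_neqAle degree_ge2 andbT.
      by have := h y; rewrite /= x'y eq_sym => /= ->.
    by rewrite dx4 m18.
  have [x'' x12 Ny] : exists2 x'', x' != x'' & [set z | adj y z] = [set x'; x''].
    by apply: degree2_neighbourhood => //; rewrite adj_sym.
  (* The equation becomes [60 * degree x'' = 144], which has no integer solution. *)
  have := degree2_neighbours x12 Ny; rewrite dx4 m18; lia.
(* Degree 4 gives [m = 36], [n = 6], [degree x' = 8]; degree 5 gives [m = 90], [n = 7],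
   [degree x' = 20]. Both contradict [degree x' <= n]. *)
- rewrite d4 in e; lia.
- rewrite d5 in e; lia.
Qed.

Lemma degree2_shape (x : G) : degree x = 2%N -> theta_shape.
Proof.
move=> dx; have [y xy] := noiso x.
have [y' yy' Nx] := degree2_neighbourhood dx xy.
have xy' : adj x y' by have /setP/(_ y') := Nx; rewrite !inE eqxx orbT.
have [dy|dy] := eqVneq (degree y) 2%N; first exact: adjacent_degree2_shape xy dy.
have [dy'|dy'] := eqVneq (degree y') 2%N; first exact: adjacent_degree2_shape xy' dy'.
have {}dy : (3 <= degree y)%N by have := degree_ge2 y; lia.
have {}dy' : (3 <= degree y')%N by have := degree_ge2 y'; lia.
case: (leqP (degree y) (degree y')) => [|/ltnW] le_d.
  by case: (no_degree3_neighbour yy' Nx dy le_d).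
rewrite eq_sym in yy'; rewrite setUC in Nx.
by case: (no_degree3_neighbour yy' Nx dy' le_d).
Qed.

End MinDegree2.

(** * Least degree at least 3, and the case split on the least degree *)

Lemma exists_small_neighbour (x : G) : exists2 y, adj x y & (degree y <= 3)%N.
Proof.
have [y /andP[xy dy]|h] := pickP [pred y | adj x y & (degree y <= 3)%N].
  by exists y.
have : (3 * 4 * degree x <= (4 - 4) * m)%N.
  by apply: degree_bound => // y xy; rewrite ltnNge; have := h y; rewrite /= xy => /= ->.
by have := degree_gt0 x; lia.
Qed.

Lemma min_degree_lt3 : (forall x : G, (3 <= degree x)%N) -> G -> False.
Proof.
move=> degree_ge3 x1.
have m0 := sum_side_gt0.
have bound (x : G) : (9 * degree x <= m)%N.
  by have := degree_bound (x := x) (k := 3) isT (fun y _ => degree_ge3 y); lia.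
(* For a common neighbour [y], [gram] gives [4 m / d_y <= 9 d_z], while [9 d_y <= m] makes the
   left-hand side at least 36. *)
have ge4 (x z : G) : degree x = 3%N -> c z = c x -> z != x -> (4 <= degree z)%N.
  move=> dx cz; rewrite eq_sym => /(gram_neq (esym cz)).
  have [y xy zy] := common_neighbour (esym cz).
  have := codegree_ge xy zy; have := bound y; rewrite dx.
  rewrite -!(ler_nat rat) natrM; have := M_gt0; have dy0 := d_gt0 y.
  set i := _^-1; have di : d y * i = 1 by rewrite mulfV ?lt0r_neq0.
  have : 0 < i by rewrite invr_gt0.
  move: (codegree _ _ _) (d y) (d z) M i di dy0 => g u v k i; nra.
have nbr3 (z : G) : exists2 y, adj z y & degree y = 3%N.
  have [y zy dy] := exists_small_neighbour z.
  by exists y => //; have := degree_ge3 y; lia.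
have unique (z w : G) : degree z = 3%N -> degree w = 3%N -> c z = c w -> z = w.
  move=> dz dw czw; have [//|zw] := eqVneq z w.
  by have := ge4 w z dw czw zw; rewrite dz.
(* Exactly one neighbour of [z] has degree 3 and the others have degree at least 4, so the codegree
   of [z] with itself is at most [1/3 + (d_z - 1)/4]. Inserting this in [gram_diag] gives the
   bound. *)
have sq (z : G) : (9 * (degree z * degree z) <= m)%N.
  have [y zy dy] := nbr3 z.
  have cg : 12 * codegree rat z z <= 3 * d z + 1.
    have -> : d z = 1 + \sum_(w in [set w | adj z w] :\ y) 1.
      rewrite -[degree z]sum1_card natr_sum (big_setD1 y) ?inE //.
    rewrite codegree_diag (big_setD1 y) ?inE //= dy.
    have le_sum : 12 * (\sum_(w in [set w | adj z w] :\ y) (d w)^-1)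
        <= 3 * \sum_(w in [set w | adj z w] :\ y) 1.
      rewrite !mulr_sumr; apply: ler_sum => w; rewrite !inE => /andP[wy zw].
      have w4 : (4 <= degree w)%N.
        have := degree_ge3 w; rewrite leq_eqVlt => /orP[/eqP w3|//].
        by rewrite (unique w y) ?eqxx // in wy; exact: c_adj2 zw zy.
      by have := inv_degree_le (k := 4) isT w4; lra.
    lra.
  rewrite -(ler_nat rat) !natrM; have := gram_diag z; have := M_gt0.
  have dz0 := d_gt0 z; move: cg.
  move: (codegree _ _ _) (d z) M dz0 => g u k; nra.
have [x _ dx] := nbr3 x1.
have [x' cx' x'x] := exists_other x.
have [y' xy' x'y'] := common_neighbour (esym cx').
have : (4 * m <= 9 * (degree x' * degree y'))%N.
  have := codegree_ge xy' x'y'; have := gram_neq (esym cx'); rewrite eq_sym x'x.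
  move=> /(_ isT); rewrite dx -(ler_nat rat) !natrM => e le_i.
  have : 4 * M * (d y')^-1 * d y' <= 4 * M * codegree rat x x' * d y'.
    by rewrite ler_pM2r ?d_gt0 // ler_pM2l ?mulr_gt0 ?M_gt0.
  rewrite e mulfVK ?lt0r_neq0 ?d_gt0 //; lra.
(* The two squares bound [9 d_x' d_y'] by [m], so [4 m <= m] although [m > 0]. *)
have := sq x'; have := sq y'; nia.
Qed.

Lemma gram_shape : G -> theta_shape.
Proof.
move=> x0.
have [x dx|ge2] := pickP [pred x : G | degree x == 1%N].
  by apply: (leaf_shape (x := x)); exact/eqP.
have {}ge2 (x : G) : (2 <= degree x)%N.
  by rewrite ltn_neqAle degree_gt0 andbT eq_sym; have /= -> := ge2 x.
have [x dx|ge3] := pickP [pred x : G | degree x == 2%N].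
  by apply: (degree2_shape ge2 (x := x)); exact/eqP.
case: min_degree_lt3 => // x.
by rewrite ltn_neqAle ge2 andbT eq_sym; have /= -> := ge3 x.
Qed.

End Gram.

(** * Reconstruction of the theta graph from its hubs and degrees *)

Section ThetaShape.

Variables (G : graph) (c : G -> bool) (t : nat).
Hypothesis c_adj : forall x y : G, adj x y -> c y = ~~ c x.
Hypothesis card_side : forall b, #|[set x | c x == b]| = t.+1.

(** The [t] neighbours of [x0] lie among the [t + 1] vertices of the opposite side and avoid [y0],
    so they exhaust the rest. *)
Lemma adj_almost_all (x0 y0 : G) : c y0 = ~~ c x0 -> ~~ adj x0 y0 ->
  degree x0 = t -> forall y, adj x0 y = (c y == ~~ c x0) && (y != y0).
Proof.
move=> cy0 nadj dx0 y.
suff /setP/(_ y) : [set z | adj x0 z] = [set z | c z == ~~ c x0] :\ y0.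
  by rewrite !inE andbC.
apply/eqP; rewrite eqEcard; apply/andP; split.
  apply/subsetP => z; rewrite !inE => x0z; rewrite (c_adj x0z) eqxx andbT.
  by apply: contraNneq nadj => <-.
have := cardsD1 y0 [set z | c z == ~~ c x0].
rewrite inE cy0 eqxx card_side add1n => -[<-].
by rewrite -dx0 /degree.
Qed.

Lemma theta_shape_isomorphic : theta_shape c t.+1 -> isomorphic G (theta2 t).
Proof.
move=> [x0 [y0 [cy0 nadj /= dx0 dy0 d2]]].
have adjx0 := adj_almost_all cy0 nadj dx0.
have adjy0 x : adj y0 x = (c x == c x0) && (x != x0).
  by rewrite (adj_almost_all (y0 := x0) _ _ dy0) ?cy0 ?negbK // adj_sym.
pose X (i : 'I_t) : G := enum_val (cast_ord (esym dy0) i).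
have y0X i : adj y0 (X i) by have := enum_valP (cast_ord (esym dy0) i); rewrite inE.
have cX i : c (X i) = c x0 by have := y0X i; rewrite adjy0 => /andP[/eqP].
have Xx0 i : X i != x0 by have := y0X i; rewrite adjy0 => /andP[].
have Xy0 i : X i != y0 by apply: contraTneq (y0X i) => ->; rewrite adj_irrefl.
have X_inj : injective X by move=> i j /enum_val_inj/cast_ord_inj.
(* [mu i] is the second neighbour of [X i], so the [i]-th path is [X i, mu i]. The default [x0] is
   never taken, by [muP]. *)
pose mu i : G := odflt x0 [pick y | adj (X i) y && (y != y0)].
have muP i : adj (X i) (mu i) && (mu i != y0).
  rewrite /mu; case: pickP => [//|h].
  have Xiy0 : adj (X i) y0 by rewrite adj_sym.
  have [y' yy' Ny'] := degree2_neighbourhood (d2 _ (Xx0 i) (Xy0 i)) Xiy0.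
  have := h y'; have /setP/(_ y') := Ny'; rewrite !inE eqxx orbT => -> /=.
  by rewrite eq_sym yy'.
have Xmu i : adj (X i) (mu i) by case/andP: (muP i).
have muy0 i : mu i != y0 by case/andP: (muP i).
have cmu i : c (mu i) = ~~ c x0 by rewrite (c_adj (Xmu i)) cX.
have mux0 i : mu i != x0.
  by apply: contra_eqN (cmu i) => /eqP ->; case: (c x0).
have x0mu i : adj x0 (mu i) by rewrite adjx0 cmu eqxx muy0.
(* [mu j] has degree 2 and one neighbour is [x0], which leaves room for a single [X i]. *)
have XmuE i j : adj (X i) (mu j) = (i == j).
  apply/idP/eqP => [Xij|->//]; apply: X_inj.
  have mujx0 : adj (mu j) x0 by rewrite adj_sym.
  have [x' _ Nx'] := degree2_neighbourhood (d2 _ (mux0 j) (muy0 j)) mujx0.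
  have N k : adj (X k) (mu j) -> X k = x'.
    rewrite adj_sym => Xk; have /setP/(_ (X k)) := Nx'.
    by rewrite !inE Xk (negPf (Xx0 k)) /= => /esym/eqP.
  by rewrite (N i) // (N j).
have same_side u v : c u = c v -> adj u v = false.
  by move=> cuv; apply/negP => /c_adj; rewrite cuv; case: (c v).
pose g (u : theta2 t) : G := match u with
  | inl a => if a then x0 else y0
  | inr (i, b) => if b then mu i else X i
  end.
have g_adj u v : adj (g u) (g v) = adj u v.
  case: u v => [a|[i a]] [b|[j b]] /=; rewrite /=.
  - by case: a b => [] []; rewrite ?adj_irrefl // ?(negPf nadj) // adj_sym (negPf nadj).
  - by case: a b => [] [] /=; rewrite ?x0mu ?y0X // same_side // ?cX // cmu cy0.
  - by case: a b => [] [] /=; rewrite adj_sym ?x0mu ?y0X // same_side // ?cX // cmu cy0.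
  case: a b => [] [] /=; rewrite ?andbT ?andbF ?XmuE //.
  - by rewrite same_side // !cmu.
  - by rewrite adj_sym XmuE eq_sym.
  - by rewrite same_side // !cX.
have g_inj : injective g.
  have neq_side u v : u = v -> c u = ~~ c v -> False by move=> ->; case: (c v).
  case=> [a|[i a]] [b|[j b]] /=.
  - case: a b => [] [] //= e; case: (neq_side _ _ e); by rewrite cy0 ?negbK.
  - case: a b => [] [] /= e.
    + by have := mux0 j; rewrite e eqxx.
    + by have := Xx0 j; rewrite e eqxx.
    + by have := muy0 j; rewrite e eqxx.
    + by have := Xy0 j; rewrite e eqxx.
  - case: a b => [] [] /= e.
    + by have := mux0 i; rewrite e eqxx.
    + by have := muy0 i; rewrite e eqxx.
    + by have := Xx0 i; rewrite e eqxx.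
    + by have := Xy0 i; rewrite e eqxx.
  case: a b => [] [] /= e.
  - by have := Xmu i; rewrite e XmuE => /eqP ->.
  - by case: (neq_side _ _ e); rewrite cmu cX.
  - by case: (neq_side _ _ e); rewrite cmu cX negbK.
  - by rewrite (X_inj _ _ e).
have card_G : #|G| = (2 * t.+1)%N.
  rewrite -cardsT -(cardsID [set x | c x == true] setT) setTI card_side.
  have -> : [set: G] :\: [set x | c x == true] = [set x | c x == false].
    by apply/setP => x; rewrite !inE; case: (c x).
  by rewrite card_side; lia.
have : bijective g.
  apply: inj_card_bij g_inj _.
  by rewrite card_G card_sum card_prod card_bool card_ord; lia.
case=> f gK fK; exists f; first by exists g.
by move=> x y; rewrite -g_adj !fK.
Qed.

End ThetaShape.

(** * The normalized adjacency matrix *)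

Lemma sum_ord_vertex (V : nmodType) (G : graph) (F : G -> V) :
  \sum_(i < #|G|) F (enum_val i) = \sum_x F x.
Proof. by rewrite -(big_enum_val (A := G)). Qed.

Lemma sum_adj_exchange (V : nmodType) (G : graph) (P Q : pred G)
    (F : G -> G -> V) :
  \sum_(x | P x) \sum_(y | Q y && adj x y) F x y =
  \sum_(y | Q y) \sum_(x | P x && adj y x) F x y.
Proof.
rewrite (exchange_big_dep Q) => [|x y _ /andP[] //].
by apply: eq_bigr => y Qy; apply: eq_bigl => x; rewrite Qy adj_sym.
Qed.

(** The adjacency operator on functions. Values in any [nmodType] allow it to express degrees in
    [nat] as well. *)
Definition walk (V : nmodType) (G : graph) (f : G -> V) (x : G) : V :=
  \sum_(y | adj x y) f y.

Section NormalizedAdjacency.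

Variables (C : numClosedFieldType) (G : graph).
Hypothesis noiso : no_isolated_vertices G.

Definition sqrt_degree (x : G) : C := sqrtC (degree x)%:R.

Local Notation s := sqrt_degree.
Local Notation d x := ((degree x)%:R : C).

Lemma degree_neq0 (x : G) : d x != 0.
Proof. by rewrite pnatr_eq0 -lt0n degree_gt0. Qed.

Lemma sqrt_degree_sq (x : G) : s x * s x = d x.
Proof. by rewrite -expr2 sqrtCK. Qed.

Lemma sqrt_degree_neq0 (x : G) : s x != 0.
Proof. by rewrite sqrtC_eq0 degree_neq0. Qed.

Lemma sqrt_degree_conj (x : G) : (s x)^* = s x.
Proof. by apply/CrealP/ger0_real; rewrite sqrtC_ge0 ler0n. Qed.

Definition normalized_adjacency : 'M[C]_#|G| :=
  1%:M - normalized_laplacian C G.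

Local Notation N := normalized_adjacency.

Lemma normalized_adjacencyE i j : N i j =
  (adj (enum_val i) (enum_val j))%:R / (s (enum_val i) * s (enum_val j)).
Proof.
rewrite /N /normalized_laplacian subKr mul_mx_diag mul_diag_mx !mxE.
by rewrite invfM mulrA [_^-1 * _]mulrC.
Qed.

Lemma normalized_adjacency_conj : N^t* = N.
Proof.
apply/matrixP => i j; rewrite mxE [X in X^*]mxE !normalized_adjacencyE adj_sym.
by rewrite fmorph_div rmorphM /= !sqrt_degree_conj conjC_nat [s _ * _]mulrC.
Qed.

Lemma normalized_laplacian_conj :
  (normalized_laplacian C G)^t* = normalized_laplacian C G.
Proof.
rewrite -[normalized_laplacian C G](subKr 1%:M) -/N linearB /= map_mxB.
by rewrite normalized_adjacency_conj trmx1 map_mx1.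
Qed.

Lemma normalized_adjacency_sqE i j : (N *m N) i j =
  codegree C (enum_val i) (enum_val j) / (s (enum_val i) * s (enum_val j)).
Proof.
rewrite mxE /codegree mulr_suml [in RHS]big_mkcond -[RHS]sum_ord_vertex /=.
apply: eq_bigr => k _; rewrite !normalized_adjacencyE.
rewrite adj_sym [adj _ (enum_val j)]adj_sym.
rewrite -sqrt_degree_sq; case: adj; case: adj; rewrite ?mul0r ?mulr0 //=.
by field; rewrite !sqrt_degree_neq0.
Qed.

Lemma trace_normalized_adjacency_sq :
  \tr (N *m N) = \sum_(x : G) codegree C x x / d x.
Proof.
rewrite -sum_ord_vertex; apply: eq_bigr => i _.
by rewrite normalized_adjacency_sqE sqrt_degree_sq.
Qed.

(** The vector [D^{1/2} f]. In this form the eigenvalue equation for [N] becomes [A f = a D f], free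
    of square roots. *)
Definition row_of_fun (f : G -> C) : 'rV[C]_#|G| :=
  \row_i (s (enum_val i) * f (enum_val i)).

Lemma row_of_fun_surj (w : 'rV[C]_#|G|) : exists f, w = row_of_fun f.
Proof.
exists (fun x => w 0 (enum_rank x) / s x); apply/rowP => i.
by rewrite mxE enum_valK mulrC divfK ?sqrt_degree_neq0.
Qed.

Lemma row_of_fun_eq0 f : (row_of_fun f == 0) = [forall x, f x == 0].
Proof.
apply/eqP/forallP => [/rowP h x|h].
  have := h (enum_rank x); rewrite !mxE enum_rankK => /eqP.
  by rewrite mulf_eq0 (negPf (sqrt_degree_neq0 x)).
by apply/rowP => i; rewrite !mxE (eqP (h _)) mulr0.
Qed.

Lemma row_of_fun_mul f :
  row_of_fun f *m N = row_of_fun (fun x : G => walk f x / d x).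
Proof.
apply/rowP => j; rewrite mxE [RHS]mxE /walk mulr_suml mulr_sumr [in RHS]big_mkcond.
rewrite -[RHS]sum_ord_vertex; apply: eq_bigr => i _.
rewrite mxE normalized_adjacencyE adj_sym -sqrt_degree_sq.
case: adj; rewrite ?(mul0r, mulr0) //=.
by field; rewrite !sqrt_degree_neq0.
Qed.

Lemma row_of_fun_eigen f a : row_of_fun f *m N = a *: row_of_fun f <->
  forall x, walk f x = a * d x * f x.
Proof.
rewrite row_of_fun_mul; split=> [/rowP h x | h].
  have := h (enum_rank x); rewrite !mxE enum_rankK [RHS]mulrCA.
  move=> /(mulfI (sqrt_degree_neq0 x)) /(congr1 ( *%R^~ (d x))).
  by rewrite mulfVK ?degree_neq0 // => ->; ring.
apply/rowP => i; rewrite !mxE h; field; exact: degree_neq0.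
Qed.

Lemma laplacian_root z : root (char_poly (normalized_laplacian C G)) z <->
  exists2 f : G -> C, forall x, walk f x = (1 - z) * d x * f x
    & exists x, f x != 0.
Proof.
have LE w : (w *m normalized_laplacian C G = z *: w) <-> (w *m N = (1 - z) *: w).
  rewrite /N; move: (normalized_laplacian C G) => L.
  by rewrite mulmxBr mulmx1 scalerBl scale1r; split=> [->//|/addrI/oppr_inj].
rewrite -eigenvalue_root_char; split=> [/eigenvalueP[w] | [f hf [x fx]]].
  have [f ->] := row_of_fun_surj w => /LE/row_of_fun_eigen hf.
  by rewrite row_of_fun_eq0 negb_forall => /existsP; exists f.
apply/eigenvalueP; exists (row_of_fun f); first exact/LE/row_of_fun_eigen.
by rewrite row_of_fun_eq0 negb_forall; apply/existsP; exists x.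
Qed.

(** The sum of [|g x + g y|^2] over ordered adjacent pairs is the quadratic form of [D + A] at [g],
    up to a factor 2. It vanishes because [(D + A) g = 0], so every term does. *)
Lemma antiharmonic_adj (g : G -> C) : (forall x, walk g x = - d x * g x) ->
  forall x y, adj x y -> g y = - g x.
Proof.
move=> hg.
have sum0 : \sum_x \sum_(y | adj x y) (g x + g y) * (g x + g y)^* = 0.
  have half : \sum_x \sum_(y | adj x y) (g x + g y) * (g x)^* = 0.
    apply: big1 => x _; rewrite -mulr_suml big_split /=.
    rewrite sumr_const -/(walk g x) hg.
    have -> : #|[pred y | adj x y]| = degree x by rewrite -cardsE.
    by rewrite -[g x *+ _]mulr_natl mulNr subrr mul0r.
  (* Expanding the conjugate gives two halves, exchanged by swapping the ends of each edge. *)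
  rewrite (eq_bigr (fun x => \sum_(y | adj x y) (g x + g y) * (g x)^* +
     \sum_(y | adj x y) (g x + g y) * (g y)^*)); last first.
    by move=> x _; rewrite -big_split; apply: eq_bigr => y _; rewrite rmorphD mulrDr.
  rewrite big_split /= half add0r.
  rewrite (sum_adj_exchange predT predT) -[RHS]half; apply: eq_bigr => y _.
  by apply: eq_bigr => x _; rewrite [g x + _]addrC.
have ge0 x : 0 <= \sum_(y | adj x y) (g x + g y) * (g x + g y)^*.
  by apply: sumr_ge0 => y _; exact: mul_conjC_ge0.
move=> x y xy; have := psumr_eq0P (fun x _ => ge0 x) sum0 (i := x) isT.
move=> /(psumr_eq0P (fun y _ => mul_conjC_ge0 _)) /(_ y xy) /eqP.
by rewrite mul_conjC_eq0 addrC addr_eq0 => /eqP.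
Qed.

End NormalizedAdjacency.

(** * The spectrum of the theta graph *)

Section Theta.

Variable t : nat.

Lemma sum_theta2 (V : nmodType) (P : pred (theta2 t)) (F : theta2 t -> V) :
  \sum_(u | P u) F u = \sum_(b : bool | P (inl b)) F (inl b) +
    \sum_(i < t) \sum_(b : bool | P (inr (i, b))) F (inr (i, b)).
Proof.
transitivity (\sum_(u : bool + 'I_t * bool | P u) F u) => //.
rewrite big_sumType; congr (_ + _).
rewrite big_mkcond /=.
rewrite (eq_bigr (fun i => \sum_b (if P (inr (i, b)) then F (inr (i, b)) else 0))).
  by rewrite pair_bigA; apply: eq_bigr => [[i b]].
by move=> i _; rewrite [LHS]big_mkcond.
Qed.

Lemma walk_theta2_hub (V : nmodType) (f : theta2 t -> V) (a : bool) :
  walk f (inl a) = \sum_(i < t) f (inr (i, a)).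
Proof.
rewrite /walk sum_theta2 big_pred0 // add0r; apply: eq_bigr => i _.
by rewrite (big_pred1 a) // => b; rewrite /= eq_sym.
Qed.

Lemma walk_theta2_path (V : nmodType) (f : theta2 t -> V) (i : 'I_t) (a : bool) :
  walk f (inr (i, a)) = f (inl a) + f (inr (i, ~~ a)).
Proof.
rewrite /walk sum_theta2 (big_pred1 a) //; congr (_ + _).
rewrite (bigD1 i) //= (big_pred1 (~~ a)) => [|b]; last first.
  by rewrite /= eqxx; case: a b => [] [].
rewrite big1 ?addr0 // => j ji; rewrite big_pred0 // => b.
by rewrite /= eq_sym (negPf ji).
Qed.

Lemma degree_walk (G : graph) (x : G) : degree x = walk (fun=> 1%N) x.
Proof. by rewrite /walk sum1_card /degree cardsE. Qed.

Lemma degree_theta2_hub (a : bool) : degree (inl a : theta2 t) = t.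
Proof. by rewrite degree_walk walk_theta2_hub sum1_card card_ord. Qed.

Lemma degree_theta2_path (i : 'I_t) (a : bool) :
  degree (inr (i, a) : theta2 t) = 2%N.
Proof. by rewrite degree_walk walk_theta2_path. Qed.

Lemma card_theta2 : #|theta2 t| = (2 * t + 2)%N.
Proof. by rewrite card_sum card_prod card_bool card_ord; lia. Qed.

Hypothesis t_gt0 : (0 < t)%N.

Lemma theta2_no_isolated : no_isolated_vertices (theta2 t).
Proof.
move=> [a|[i a]]; first by exists (inr (Ordinal t_gt0, a)) => /=.
by exists (inl a) => /=.
Qed.

Section ThetaSpectrum.

Variable C : numClosedFieldType.

Let t_neq0 : t%:R != 0 :> C. Proof. by rewrite pnatr_eq0 -lt0n. Qed.

(** Eliminating the path vertices and summing over the paths leaves [T f(b) = f(~~ b)] on the hubs,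
    where [T = 4 a^3 - 3 a] is a Chebyshev polynomial. Applying this twice,
    [T^2 - 1 = (a^2 - 1) (4 a^2 - 1)^2] kills the hub values. If neither factor vanishes, [f] is 0
    on the hubs and then on the paths. *)
Lemma theta2_eigenvalue (a : C) (f : theta2 t -> C) :
  (forall x, walk f x = a * (degree x)%:R * f x) -> (exists x, f x != 0) ->
  a ^+ 2 = 1 \/ 4 * a ^+ 2 = 1.
Proof.
move=> hf [x fx]; have [/eqP|a1] := eqVneq (a ^+ 2 - 1) 0.
  by rewrite subr_eq0 => /eqP; left.
have [/eqP|a2] := eqVneq (4 * a ^+ 2 - 1) 0.
  by rewrite subr_eq0 => /eqP; right.
have path i b : 2 * a * f (inr (i, b)) = f (inl b) + f (inr (i, ~~ b)).
  by rewrite -walk_theta2_path hf degree_theta2_path; ring.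
have pathE i b :
    (4 * a ^+ 2 - 1) * f (inr (i, b)) = 2 * a * f (inl b) + f (inl (~~ b)).
  transitivity (2 * a * (2 * a * f (inr (i, b))) - f (inr (i, b))); first ring.
  by rewrite path mulrDr path negbK; ring.
have hubE b : (4 * a ^+ 3 - 3 * a) * f (inl b) = f (inl (~~ b)).
  apply: (mulfI t_neq0).
  have := hf (inl b); rewrite walk_theta2_hub degree_theta2_hub.
  move=> /(congr1 ( *%R (4 * a ^+ 2 - 1))); rewrite mulr_sumr.
  rewrite (eq_bigr _ (fun i _ => pathE i b)) sumr_const card_ord.
  rewrite -[_ *+ t]mulr_natl => e; apply/eqP; rewrite -subr_eq0.
  apply/eqP; transitivity ((4 * a ^+ 2 - 1) * (a * t%:R * f (inl b)) -
    t%:R * (2 * a * f (inl b) + f (inl (~~ b)))); first ring.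
  by rewrite e subrr.
have hub0 b : f (inl b) = 0.
  have h : (a ^+ 2 - 1) * ((4 * a ^+ 2 - 1) ^+ 2 * f (inl b)) = 0.
    transitivity ((4 * a ^+ 3 - 3 * a) *
      ((4 * a ^+ 3 - 3 * a) * f (inl b)) - f (inl b)).
      ring.
    by rewrite !hubE negbK subrr.
  move/eqP: h; rewrite mulf_eq0 (negPf a1) mulf_eq0 expf_eq0 (negPf a2) /=.
  by move/eqP.
case/eqP: fx; case: x => [b|[i b]]; first exact: hub0.
by apply: (mulfI a2); rewrite pathE !hub0 !mulr0 addr0.
Qed.

Lemma theta2_antiharmonic : exists2 f : theta2 t -> C,
  forall x, walk f x = - (degree x)%:R * f x & exists x, f x != 0.
Proof.
(* The function takes the values 1 and -1 on the two sides of the bipartition. *)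
pose sg (a : bool) : C := (-1) ^+ a.
exists (fun x : theta2 t => match x with inl a => sg a | inr (_, a) => - sg a end).
  case=> [a|[i a]].
    rewrite walk_theta2_hub degree_theta2_hub sumr_const card_ord.
    by rewrite mulNr mulr_natl mulNrn.
  rewrite walk_theta2_path degree_theta2_path; rewrite /sg; case: a => /=; ring.
by exists (inl false); rewrite /sg /= expr0 oner_neq0.
Qed.

(** The left-hand side is [4 tr(N^2)]. Each hub contributes [1/2] to the sum and each path
    [1/t + 1/2]. *)
Lemma sum_codegree_theta2 :
  4 * (\sum_(x : theta2 t) codegree C x x / (degree x)%:R) = (2 * t + 2)%:R + 6.
Proof.
have codegE x : codegree C x x = walk (fun y : theta2 t => (degree y)%:R^-1) x.
  by apply: eq_bigl => y; rewrite andbb.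
rewrite sum_theta2 (eq_bigr (fun=> 2^-1)); last first.
  move=> b _; rewrite codegE walk_theta2_hub degree_theta2_hub.
  rewrite (eq_bigr (fun=> 2^-1)) => [|i _]; last by rewrite degree_theta2_path.
  by rewrite sumr_const card_ord -[_ *+ t]mulr_natl mulrAC divff ?mul1r.
rewrite [X in _ * (_ + X)](eq_bigr (fun=> t%:R^-1 + 2^-1)); last first.
  move=> i _; rewrite (eq_bigr (fun=> (t%:R^-1 + 2^-1) / 2)).
    by rewrite big_bool /=; field.
  move=> b _; rewrite codegE walk_theta2_path degree_theta2_hub.
  by rewrite !degree_theta2_path.
rewrite big_bool sumr_const card_ord -[_ *+ t]mulr_natl natrD natrM /=.
by field.
Qed.

End ThetaSpectrum.

End Theta.

(** * Graphs cospectral with the theta graph *)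

Section GramOfSpectrum.

Variables (C : numClosedFieldType) (G : graph).
Hypothesis noiso : no_isolated_vertices G.

Local Notation N := (normalized_adjacency C G).
Local Notation s := (@sqrt_degree C G).
Local Notation d x := ((degree x)%:R : C).

Hypothesis annihilated : 4 *: ((N *m N) *m (N *m N)) = 5 *: (N *m N) - 1%:M.
Hypothesis trace : 4 * \tr (N *m N) = #|G|%:R + 6.

Variable g : G -> C.
Hypothesis g_anti : forall x, walk g x = - d x * g x.
Variable x0 : G.
Hypothesis gx0 : g x0 != 0.

Let v := row_of_fun (fun=> 1 : C) : 'rV_#|G|.
Let w := row_of_fun g.

Let walk_const (k : C) (x : G) : walk (fun=> k) x = d x * k.
Proof.
rewrite /walk sumr_const mulr_natl.
by have -> : #|[pred y | adj x y]| = degree x by rewrite -cardsE.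
Qed.

Let vN : v *m N = v.
Proof.
rewrite -[RHS]scale1r; apply/(row_of_fun_eigen noiso) => x.
by rewrite walk_const mul1r.
Qed.

Let wN : w *m N = - w.
Proof.
rewrite -scaleN1r; apply/(row_of_fun_eigen noiso) => x.
by rewrite g_anti mulN1r.
Qed.

Let v0 : v != 0.
Proof.
rewrite row_of_fun_eq0 // negb_forall; apply/existsP; exists x0; exact: oner_neq0.
Qed.

Let w0 : w != 0.
Proof. by rewrite row_of_fun_eq0 // negb_forall; apply/existsP; exists x0. Qed.

Let resolution := spectral_projections (normalized_adjacency_conj C G) vN wN
  v0 w0 annihilated trace.

(* g^2 is harmonic, hence proportional to 1. *)
Let g_sq x : g x * g x = g x0 * g x0.
Proof.
have gN := antiharmonic_adj g_anti.
pose u := row_of_fun (fun x => g x * g x).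
have uN : u *m N = u.
  rewrite -[RHS]scale1r; apply/(row_of_fun_eigen noiso) => y.
  rewrite mul1r -walk_const; apply: eq_bigr => z yz.
  by rewrite (gN _ _ yz) mulrNN.
(* Applying [resolution] to [u] gives [3 u = a v + b w], and applying [N] to this gives
   [3 u = a v - b w]; adding them eliminates [w]. *)
have uv : exists k, u = k *: v.
  have := congr1 (mulmx u) resolution.
  rewrite mulmxBr mulmx1 -scalemxAr mulmxA uN uN mulmxDr -!scalemxAr !mulmxA.
  move: (3 / _) (3 / _) => b a.
  rewrite [u *m v^t*]mx11_scalar [u *m w^t*]mx11_scalar !mul_scalar_mx !scalerA.
  move: (a * _) (b * _) => {}a {}b e.
  have e3 : 3 *: u = a *: v + b *: w.
    by rewrite -e -[X in _ - X]scale1r -scalerBl; congr (_ *: _); ring.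
  have := congr1 (mulmx^~ N) e3.
  rewrite mulmxDl -!scalemxAl uN vN wN scalerN => e4.
  exists (a / 3); apply: (scalerI (a := 6)); first by rewrite pnatr_eq0.
  have -> : 6 *: u = 3 *: u + 3 *: u by rewrite -scalerDl; congr (_ *: _); ring.
  rewrite {1}e3 e4 addrACA subrr addr0 -scalerDl scalerA.
  by congr (_ *: _); field.
have [k /rowP ukv] := uv.
have gk y : g y * g y = k.
  have := ukv (enum_rank y); rewrite !mxE enum_rankK mulr1 mulrC.
  by move/(mulIf (sqrt_degree_neq0 C noiso y)).
by rewrite !gk.
Qed.

Let g_sign x : g x = g x0 \/ g x = - g x0.
Proof.
have := g_sq x; rewrite -!expr2 => /eqP; rewrite eqf_sqr => /orP[]/eqP; by [left|right].
Qed.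

(** The sides are the two values of [g]. On one side the [v] and [w] terms of [resolution] agree,
    since [|g x0|^2] cancels against the norm of [w]; each is [3 / D] times [s x * s x'], with [D]
    the total degree. *)
Lemma bipartite_gram : exists2 c : G -> bool,
  forall x y, adj x y -> c y = ~~ c x
  & forall x x', c x = c x' -> (\sum_(y : G) degree y)%N%:R *
      (4 * codegree C x x' - (x == x')%:R * d x) = 6 * d x * d x'.
Proof.
have gx0N : - g x0 != g x0 by rewrite -subr_eq0 -opprD oppr_eq0 -mulr2n mulrn_eq0.
exists (fun x => g x == g x0) => [x y xy|x x' cxx'].
  rewrite (antiharmonic_adj g_anti xy); case: (g_sign x) => ->.
    by rewrite eqxx (negPf gx0N).
  by rewrite opprK eqxx (negPf gx0N).
have gg : (g x)^* * g x' = g x0 * (g x0)^*.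
  rewrite mulrC; move: cxx'; case: (g_sign x) => ->; case: (g_sign x') => -> //.
  - by rewrite eqxx (negPf gx0N).
  - by rewrite eqxx (negPf gx0N).
  - by rewrite rmorphN mulrNN.
have ggx y : g y * (g y)^* = g x0 * (g x0)^*.
  by case: (g_sign y) => -> //; rewrite rmorphN mulrNN.
set D := (\sum_(y : G) degree y)%N%:R.
have vv : (v *m v^t*) 0 0 = D.
  rewrite mxE /D natr_sum -[RHS]sum_ord_vertex; apply: eq_bigr => i _.
  by rewrite !mxE !mulr1 sqrt_degree_conj sqrt_degree_sq.
have ww : (w *m w^t*) 0 0 = D * (g x0 * (g x0)^*).
  rewrite mxE /D natr_sum mulr_suml -[RHS]sum_ord_vertex; apply: eq_bigr => i _.
  rewrite !mxE rmorphM /= sqrt_degree_conj -(ggx (enum_val i)) -sqrt_degree_sq.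
  by ring.
have D0 : D != 0.
  rewrite pnatr_eq0 -lt0n (bigD1 x0) //= addn_gt0.
  by rewrite (degree_gt0 noiso).
have nz : g x0 * (g x0)^* != 0 by rewrite mul_conjC_eq0.
have /matrixP/(_ (enum_rank x))/(_ (enum_rank x')) := resolution.
rewrite vv ww; move: (normalized_adjacency_sqE C noiso (enum_rank x) (enum_rank x')).
rewrite !enum_rankK; move: (N *m N) => Q eQ.
rewrite !mxE !big_ord1 !mxE eQ !enum_rankK !mulr1 rmorphM /= !sqrt_degree_conj.
rewrite (inj_eq enum_rank_inj).
rewrite [_ * (g x)^* * _]mulrACA gg => e.
have sx := sqrt_degree_neq0 C noiso x; have sx' := sqrt_degree_neq0 C noiso x'.
have {e} e : 4 * (codegree C x x' / (s x * s x')) - (x == x')%:R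
    = 6 / D * (s x * s x').
  by rewrite e; move: (_ * _^*) nz => P P0; field; rewrite D0 P0.
rewrite -!sqrt_degree_sq.
have -> : (x == x')%:R * (s x * s x) = (x == x')%:R * (s x * s x').
  by case: eqP => [->|_]; rewrite ?mul0r.
transitivity (D * (s x * s x') *
   (4 * (codegree C x x' / (s x * s x')) - (x == x')%:R)).
  by field; rewrite sx sx'.
by rewrite e; field.
Qed.

End GramOfSpectrum.

(** Used to carry the Gram identity from [C] to [rat], whose total order the degree arguments rely
    on. *)
Lemma ratr_codegree (C : numClosedFieldType) (G : graph) (x x' : G) :
  ratr (codegree rat x x') = codegree C x x'.
Proof.
by rewrite rmorph_sum; apply: eq_bigr => y _; rewrite fmorphV rmorph_nat.
Qed.

(** * Equality of the two sides of the bipartition *)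

Section Bipartite.

Variables (G : graph) (c : G -> bool).
Hypothesis noiso : no_isolated_vertices G.
Hypothesis c_adj : forall x y : G, adj x y -> c y = ~~ c x.

Lemma side_exchange (V : nmodType) (F : G -> G -> V) (b : bool) :
  \sum_(x | c x == b) \sum_(y | adj x y) F x y =
  \sum_(y | c y == ~~ b) \sum_(x | adj y x) F x y.
Proof.
transitivity (\sum_(x | c x == b) \sum_(y | (c y == ~~ b) && adj x y) F x y).
  apply: eq_bigr => x /eqP cx; apply: eq_bigl => y.
  by have [/c_adj ->|] := boolP (adj x y); rewrite ?andbF // cx eqxx.
rewrite sum_adj_exchange; apply: eq_bigr => y /eqP cy; apply: eq_bigl => x.
by have [/c_adj ->|] := boolP (adj y x); rewrite ?andbF // cy negbK eqxx.
Qed.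

Lemma sum_degree_side (b : bool) :
  (\sum_(x | c x == b) degree x = \sum_(x | c x == true) degree x)%N.
Proof.
case: b => //.
rewrite (eq_bigr _ (fun x _ => degree_walk x)) [LHS]side_exchange /=.
by apply: eq_bigr => x _; rewrite degree_walk.
Qed.

Lemma sum_degree_bipartite :
  (\sum_(x : G) degree x = 2 * \sum_(x | c x == true) degree x)%N.
Proof.
rewrite (bigID (fun x => c x == true)) /=.
rewrite [X in (_ + X)%N](eq_bigl (fun x => c x == false)).
  by rewrite sum_degree_side mul2n addnn.
by move=> x; case: (c x).
Qed.

Local Notation m := (\sum_(x | c x == true) degree x)%N.
Local Notation d x := ((degree x)%:R : rat).

Hypothesis gram : forall x x', c x = c x' ->
  4 * m%:R * codegree rat x x' = (x == x')%:R * m%:R * d x + 3 * d x * d x'.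

(** The sum of [1 / (d_x d_y)] over all edges can be computed from either side. By the diagonal Gram
    identity, a side of size [k] yields [k / 4 + 3 / 4]. *)
Lemma card_side_eq (b : bool) : G ->
  #|[set x | c x == b]| = #|[set x | c x == ~~ b]|.
Proof.
move=> x1.
have m0 : (0 < m)%N.
  have [cx|cx] := boolP (c x1 == true).
    by rewrite (bigD1 x1) //= addn_gt0 degree_gt0.
  rewrite -(sum_degree_side false) (bigD1 x1) /=; last by case: (c x1) cx.
  by rewrite addn_gt0 degree_gt0.
have m0' : m%:R != 0 :> rat by rewrite pnatr_eq0 -lt0n.
have side_sum b' : \sum_(x | c x == b') \sum_(y | adj x y) (d x)^-1 * (d y)^-1
    = #|[set x | c x == b']|%:R / 4 + 3 / 4.
  have -> : 3 / 4 = \sum_(x | c x == b') 3 / (4 * m%:R) * d x.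
    by rewrite -mulr_sumr -natr_sum sum_degree_side; field.
  have -> : #|[set x | c x == b']|%:R / 4 = \sum_(x | c x == b') 4^-1 :> rat.
    by rewrite mulr_natl cardsE sumr_const.
  rewrite -big_split; apply: eq_bigr => x _ /=.
  have dx0 : d x != 0 by rewrite pnatr_eq0 -lt0n degree_gt0.
  rewrite -mulr_sumr -[\sum_(_ | _) _]/(walk _ x).
  have -> : walk (fun y : G => (d y)^-1) x = codegree rat x x.
    by apply: eq_bigl => y; rewrite andbb.
  apply: (mulfI (x := 4 * m%:R * d x)); first by rewrite !mulf_neq0.
  transitivity (4 * m%:R * codegree rat x x); first by field.
  by rewrite gram // eqxx mul1r; field.
have : #|[set x | c x == b]|%:R / 4 + 3 / 4
     = #|[set x | c x == ~~ b]|%:R / 4 + 3 / 4 :> rat.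
  rewrite -!side_sum side_exchange; apply: eq_bigr => x _.
  by apply: eq_bigr => y _; rewrite mulrC.
move/addIr/(mulIf _) => h; apply/eqP; rewrite -(eqr_nat rat).
by apply/eqP/h; rewrite invr_eq0.
Qed.

End Bipartite.

Theorem corollary5p6 (C : numClosedFieldType) (t : nat) (t_gt0 : (0 < t)%N)
    (H : graph) (H_noiso : no_isolated_vertices H)
    (H_Spec : Spec (normalized_laplacian C H) =
              Spec (normalized_laplacian C (theta2 t))) :
  isomorphic H (theta2 t).
Proof.
have cp : char_poly (normalized_laplacian C H)
        = char_poly (normalized_laplacian C (theta2 t)).
  by rewrite !char_poly_Spec H_Spec.
have cardH : #|H| = (2 * t + 2)%N.
  have := congr1 (fun p => size (polyseq p)) cp.
  by rewrite !size_char_poly card_theta2 => -[].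
have T_noiso := theta2_no_isolated t_gt0.
have trace : 4 * \tr (normalized_adjacency C H *m normalized_adjacency C H)
    = #|H|%:R + 6.
  rewrite (trace_sq_sub1 (normalized_laplacian_conj C H)
    (normalized_laplacian_conj C (theta2 t)) cp).
  by rewrite trace_normalized_adjacency_sq // sum_codegree_theta2 // cardH.
have ann := annihilated_sub1 (normalized_laplacian_conj C H).
have {}ann : 4 *: ((normalized_adjacency C H *m normalized_adjacency C H) *m
      (normalized_adjacency C H *m normalized_adjacency C H)) =
    5 *: (normalized_adjacency C H *m normalized_adjacency C H) - 1%:M.
  apply: ann => z; rewrite cp => /(laplacian_root T_noiso)[f].
  exact: theta2_eigenvalue.
have [g g_anti [x0 gx0]] : exists2 g : H -> C,
    forall x, walk g x = - (degree x)%:R * g x & exists x, g x != 0.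
  (* The eigenvalue 2 of the Laplacian is the eigenvalue -1 of [N]. *)
  have : root (char_poly (normalized_laplacian C H)) 2.
    rewrite cp; apply/(laplacian_root T_noiso).
    have [f hf f0] := theta2_antiharmonic t C; exists f => // x.
    by rewrite hf; ring.
  case/(laplacian_root H_noiso) => f hf f0; exists f => // x.
  by rewrite hf; ring.
have [c c_adj gramC] := bipartite_gram H_noiso ann trace g_anti gx0.
pose m := (\sum_(x | c x == true) degree x)%N.
have gram x x' : c x = c x' -> 4 * m%:R * codegree rat x x' =
    (x == x')%:R * m%:R * (degree x)%:R + 3 * (degree x)%:R * (degree x')%:R.
  move=> /gramC; rewrite (sum_degree_bipartite c_adj) -/m -ratr_codegree natrM.
  move=> e; apply: (fmorph_inj (ratr : rat -> C)).
  rewrite !(rmorphM, rmorphD, rmorph_nat) /=.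
  (* The total degree in [bipartite_gram] is [2 * m], whence the factor 2. *)
  apply: (mulfI (x := 2)); first by rewrite pnatr_eq0.
  rewrite -[LHS](subrK (2 * ((x == x')%:R * m%:R * (degree x)%:R))).
  rewrite [RHS]mulrDr [RHS]addrC; congr (_ + _).
  transitivity (2 * m%:R * (4 * ratr (codegree rat x x') -
    (x == x')%:R * (degree x)%:R) : C).
    by ring.
  by rewrite e; ring.
have card_side b : #|[set x | c x == b]| = t.+1.
  have e : (#|[set x | c x == true]| + #|[set x | c x == false]| = 2 * t + 2)%N.
    rewrite -cardH -cardsT -(cardsID [set x | c x == true] setT) setTI.
    congr (_ + #|pred_of_set _|)%N; apply/setP => x; rewrite !inE.
    by case: (c x).
  have := card_side_eq H_noiso c_adj gram true x0 => /= e2.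
  by case: b; lia.
apply: (theta_shape_isomorphic c_adj card_side).
apply: (gram_shape H_noiso c_adj card_side (sum_degree_side c_adj) _ gram x0).
by rewrite ltnS.
Qed.
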